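(* Let $F$ be a positively expansive cellular automaton acting on $A^{\mathbb{Z}}$. Then there is a constant $\Lambda>0$ such that, for all $x\in A^{\mathbb{Z}}$, $\lambda^+(x)\ge\Lambda$ and $\lambda^-(x)\ge\Lambda$, where $\lambda^+(x)$ and $\lambda^-(x)$ are respectively the right and left pointwise Lyapunov exponents.
   Context: $A$ is a finite alphabet; $A^{\mathbb{Z}}$ is the set of bi-infinite sequences $x=(x_i)_{i\in\mathbb{Z}}$ with the metric $d(x,y)=2^{-i}$, $i=\min\{|j|: x_j\neq y_j\}$ (and $d(x,x)=0$). A cellular automaton is a continuous map $F:A^{\mathbb{Z}}\to A^{\mathbb{Z}}$ commuting with the shift $\sigma(x)_i=x_{i+1}$. $F$ is positively expansive if there is $\epsilon>0$ such that for all $x\ne y$ in $A^{\mathbb{Z}}$ there is $n\in\mathbb{N}$ with $d(F^n(x),F^n(y))\ge\epsilon$. For $x\in A^{\mathbb{Z}}$ and $s\in\mathbb{Z}$ let $W_s^+(x)=\{y\in A^{\mathbb{Z}}:\forall i\ge s,\ y_i=x_i\}$ and $W_s^-(x)=\{y\in A^{\mathbb{Z}}:\forall i\le s,\ y_i=x_i\}$. For $n\ge 1$ let $$I^-_n(x)=\min\{s\in\mathbb{N}:\forall 1\le i\le n,\ F^i(W^-_s(x))\subset W^-_0(F^i(x))\},$$ $$I^+_n(x)=\min\{s\in\mathbb{N}:\forall 1\le i\le n,\ F^i(W^+_{-s}(x))\subset W^+_0(F^i(x))\},$$ where $\mathbb{N}$ contains $0$. The pointwise Lyapunov exponents are $\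lambda^{\pm}(x)=\liminf_{n\to\infty}\frac{I_n^{\pm}(x)}{n}$.
   Formalization: The alphabet A is assumed to have at least two letters; for a one-letter alphabet the space is a single point, its only automaton is vacuously positively expansive, and both exponents are 0, so the claim fails. *)

(* Defs.v *)
From HB Require Import structures.
From mathcomp Require Import all_boot all_order all_algebra.
From mathcomp Require Import all_classical all_reals all_analysis.

Set Implicit Arguments.
Unset Strict Implicit.
Unset Printing Implicit Defensive.

Import Order.TTheory GRing.Theory Num.Theory.
Import numFieldTopology.Exports.

Local Open Scope classical_set_scope.
Local Open Scope ring_scope.

(* Total minimum of a set of naturals; the junk value on [set0] is [0]. *)
Definition min_nat (S : set nat) : nat :=
  match pselect (exists n, `[< S n >]) with
  | left exS => ex_minn exS
  | right _ => 0%N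
  end.

Lemma min_natP (S : set nat) : S !=set0 ->
  S (min_nat S) /\ forall n, S n -> (min_nat S <= n)%N.
Proof.
move=> [n Sn]; rewrite /min_nat; case: pselect => [exS|]; last first.
  by case; exists n; apply/asboolP.
case: ex_minnP => m /asboolP Sm minm; split=> // k Sk.
by apply: minm; apply/asboolP.
Qed.

(* [R] only records the field in which the metric takes its values, so that
   the metric structure below can be inferred from the type. *)
Definition config (R : realType) (A : finType) : Type := int -> A.

HB.instance Definition _ (R : realType) (A : finType) :=
  Choice.copy (config R A) (int -> A).

Section config_metric.
Context {R : realType} {A : finType}.
Implicit Types x y z : config R A.

Definition disagreement x y : set nat :=
  [set n | exists2 j : int, x j <> y j & n = `|j|%N].

Definition cdist x y : R :=
  if `[< x = y >] then 0 else 2 ^- min_nat (disagreement x y).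

Lemma disagreementC x y : disagreement x y = disagreement y x.
Proof. by apply/seteqP; split=> n [j xy ->]; exists j => // /esym. Qed.

Lemma disagreement_neq0 x y : x <> y -> disagreement x y !=set0.
Proof.
move=> xy; apply: contrapT => /nonemptyPn d0; apply: xy; apply: funext => j.
apply: contrapT => xyj; have : disagreement x y `|j|%N by exists j.
by rewrite d0.
Qed.

Lemma cdistxx x : cdist x x = 0.
Proof. by rewrite /cdist; case: asboolP. Qed.

Lemma cdist_ge0 x y : 0 <= cdist x y.
Proof. by rewrite /cdist; case: asboolP => // _; rewrite invr_ge0 exprn_ge0. Qed.

Lemma cdist_positivity x y : cdist x y = 0 -> x = y.
Proof.
by rewrite /cdist; case: asboolP => // _ /eqP; rewrite invr_eq0 expf_eq0 pnatr_eq0 andbF.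
Qed.

Lemma cdistC x y : cdist x y = cdist y x.
Proof.
rewrite /cdist disagreementC; case: asboolP => [->|xy]; case: asboolP => //.
by move=> /esym.
Qed.

Lemma cdist_triangle y x z : cdist x z <= cdist x y + cdist y z.
Proof.
have [->|xy] := pselect (x = y); first by rewrite cdistxx add0r.
have [->|yz] := pselect (y = z); first by rewrite cdistxx addr0.
have [->|xz] := pselect (x = z); first by rewrite cdistxx addr_ge0 ?cdist_ge0.
have [[j xzj jE] _] := min_natP (disagreement_neq0 xz).
have le_cdist u v : u <> v -> u j <> v j -> cdist x z <= cdist u v.
  move=> uv uvj; rewrite /cdist; case: asboolP => // _; case: asboolP => // _.
  rewrite lef_pV2 ?posrE ?exprn_gt0// ler_weXn2l ?ler1n// jE.
  by apply: (min_natP (disagreement_neq0 uv)).2; exists j.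
have [xyj|xyj] := pselect (x j = y j).
  by rewrite (le_trans (le_cdist y z _ _)) ?lerDr ?cdist_ge0// -xyj.
by rewrite (le_trans (le_cdist x y _ _)) ?lerDl ?cdist_ge0.
Qed.

HB.instance Definition _ := @isMetric.Build R (config R A)
  cdist cdistxx cdist_positivity cdistC cdist_triangle.

End config_metric.

Section cellular_automata.
Context {R : realType} {A : finType}.
Implicit Types (x y : config R A) (F : config R A -> config R A).

Definition cshift x : config R A := fun i => x (i + 1).

Definition cellular_automaton F : Prop :=
  continuous F /\ forall x, F (cshift x) = cshift (F x).

Definition positively_expansive F : Prop :=
  exists2 eps : R, 0 < eps &
    forall x y, x <> y -> exists n : nat, eps <= mdist (iter n F x) (iter n F y).

Definition Wplus (s : int) x : set (config R A) :=
  [set y | forall i : int, s <= i -> y i = x i].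

Definition Wminus (s : int) x : set (config R A) :=
  [set y | forall i : int, i <= s -> y i = x i].

(* When [F] is a cellular automaton of radius [r], the sets minimized below
   contain [r * n], so [min_nat] is a genuine minimum. *)
Definition Iminus F (n : nat) x : nat :=
  min_nat [set s : nat | forall i : nat, (1 <= i <= n)%N ->
    iter i F @` Wminus s%:Z x `<=` Wminus 0 (iter i F x)].

Definition Iplus F (n : nat) x : nat :=
  min_nat [set s : nat | forall i : nat, (1 <= i <= n)%N ->
    iter i F @` Wplus (- s%:Z) x `<=` Wplus 0 (iter i F x)].

(* The value at [n = 0], where the quotient is [0 / 0 = 0], does not affect
   the lower limit. *)
Definition lambda_minus F x : \bar R :=
  limn_einf (fun n => ((Iminus F n x)%:R / n%:R)%:E).

Definition lambda_plus F x : \bar R :=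
  limn_einf (fun n => ((Iplus F n x)%:R / n%:R)%:E).

End cellular_automata.

(* Main.v *)
Require Import Defs.
From mathcomp Require Import all_boot all_order all_algebra.
From mathcomp Require Import all_classical all_reals all_analysis.
From mathcomp Require Import zify.

Set Implicit Arguments.
Unset Strict Implicit.
Unset Printing Implicit Defensive.

Import Order.TTheory GRing.Theory Num.Theory.
Local Open Scope classical_set_scope.
Local Open Scope ring_scope.

(** Expansivity makes information about the present leak sideways at a uniform
    rate.  By compactness of the space of configurations, the expansivity
    window [[-p, p]] can be exploited in bounded time: there is [N] such that
    two configurations whose orbits agree on [[c - p, c + p]] at the times
    [0, ..., N - 1] already agree on [[c - p - 1, c + p + 1]]
    ([uniform_expansivity]; the centre [c] is arbitrary since the automaton
    commutes with the shift).

    Suppose now that [x] and [y] have orbits that agree on [j <= 0] at all the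
    times [0, ..., n].  Sliding the window along the boundary of this half line
    shows that they agree on [j <= 1] at the times [0, ..., n - N], on [j <= 2]
    at the times [0, ..., n - 2N], and so on ([ray_propagation]).  Let [s] be
    the [n]-th front of [x], and let [y] differ from [x] at the single
    coordinate [s + 1].  By definition of the front the two orbits agree on
    [j <= 0] up to time [n]; if [(s + 1) N <= n], they would agree at time [0]
    on [j <= s + 1], which is false.  Hence [n < (s + 1) N], so the quotient
    front / [n] is at least [1 / N - 1 / n], and at least [1 / (2N)] as soon as
    [n >= 2N] ([front_speed]).

    This uses that the front is a genuine minimum, which is the finite radius
    of a cellular automaton ([ca_radius]).  The radius and the uniform form of
    expansivity are two instances of one compactness statement
    ([finite_observation]).  The left and right exponents are treated together
    by orienting the line. *)

(** * Configurations and compactness *)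

Section Configurations.
Context {R : realType} {A : finType}.
Implicit Types (x y : config R A) (u : nat -> config R A).

Definition agree (D : set int) x y : Prop := forall j, D j -> x j = y j.

Definition window (c : int) (k : nat) : set int := [set j | `|j - c| <= k%:Z].

Lemma agree_sym D x y : agree D x y -> agree D y x.
Proof. by move=> xy j Dj; rewrite xy. Qed.

Lemma agree_trans D y x z : agree D x y -> agree D y z -> agree D x z.
Proof. by move=> xy yz j Dj; rewrite xy ?yz. Qed.

Lemma mdist_windowP x y k :
  mdist x y < 2 ^- k <-> agree (window 0 k) x y.
Proof.
change (mdist x y) with (cdist x y); rewrite /cdist; case: asboolP => [->|xy].
  by split=> // _; rewrite invr_gt0 exprn_gt0.
have [[j xyj jE] minj] := min_natP (disagreement_neq0 xy).
rewrite ltf_pV2 ?posrE ?exprn_gt0// ltr_eXn2l ?ltr1n//.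
split=> [lt_k i|agr].
  rewrite /window /= subr0 => ik; apply: contrapT => xyi.
  by have := minj `|i|%N (ex_intro2 _ _ i xyi erefl); lia.
rewrite ltnNge; apply/negP => le_k; apply: xyj; apply: agr.
by rewrite /window /= subr0; lia.
Qed.

Lemma nbhs_window x k : nbhs x [set y | agree (window 0 k) x y].
Proof.
apply/nbhs_ballP; exists (2 ^- k); first by rewrite /= invr_gt0 exprn_gt0.
by move=> y; rewrite ballEmdist => /mdist_windowP.
Qed.

Lemma inv_expn_lt (e : R) : 0 < e -> exists k : nat, 2 ^- k < e.
Proof.
move=> e0; have /filter_ex[k] := near_infty_natSinv_expn_lt (PosNum e0).
by rewrite div1r; exists k.
Qed.

(** A window has finitely many cells, so coordinatewise convergence is already
    convergence for the metric. *)
Lemma cvg_window (U : set_system nat) u x : Filter U ->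
  (forall j, \forall n \near U, x j = u n j) -> u @ U --> x.
Proof.
move=> FU ux; apply/cvg_ballP => e /inv_expn_lt[k ke].
have := @filter_forall _ 'I_(k.*2.+1) _ U FU (fun i => ux (i%:Z - k%:Z)).
apply: filterS => n xu; rewrite ballEmdist; apply: lt_trans ke.
apply/mdist_windowP => j; rewrite /window /= subr0 => jk.
have lt_i : (`|(j + k%:Z)%R| < k.*2.+1)%N by lia.
have := xu (Ordinal lt_i); rewrite /= (_ : _ - _ = j) //; lia.
Qed.

(** Compactness of the space of configurations: each coordinate takes finitely
    many values, so an ultrafilter selects one of them. Working with a fixed
    ultrafilter gives limits of several sequences at once, without extracting
    subsequences. *)
Lemma ultralimit (U : set_system nat) u : UltraFilter U ->
  exists x, u @ U --> x.
Proof.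
move=> UU; suff /choice[x ux] j : exists a, \forall n \near U, a = u n j.
  by exists x; apply: cvg_window.
apply: contrapT => /forallNP noa.
have /filter_ex[n nP] : \forall n \near U, forall a, a <> u n j.
  apply: filter_forall => a.
  by have [/(noa a)|] := in_ultra_setVsetC [set n | a = u n j] UU.
exact: nP erefl.
Qed.

(** If a sequence of continuous observations, each read through a finite window,
    separates configurations, then finitely many of them determine any finite
    window of a continuous image. Otherwise there are pairs [x N], [y N] with
    the same first [N] observations and different images; along an ultrafilter
    finer than [\oo] they converge to limits with the same observations, hence
    to the same limit, and continuity at this limit makes the images agree. *)
Lemma finite_observation (H : nat -> config R A -> config R A) (w : nat -> nat)
    (G : config R A -> config R A) (k : nat) :
    (forall i, continuous (H i)) -> continuous G ->
    (forall x y, (forall i, agree (window 0 (w i)) (H i x) (H i y)) -> x = y) ->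
  exists N : nat, forall x y,
    (forall i, (i < N)%N -> agree (window 0 (w i)) (H i x) (H i y)) ->
    agree (window 0 k) (G x) (G y).
Proof.
move=> cH cG sep; apply: contrapT => /forallNP noN.
have /choice[x /choice[y xyP]] : forall N, exists x, exists y,
    (forall i, (i < N)%N -> agree (window 0 (w i)) (H i x) (H i y)) /\
    ~ agree (window 0 k) (G x) (G y).
  move=> N; have /existsNP[x /existsNP[y /not_implyP xyP]] := noN N.
  by exists x, y.
have [U [UU ooU]] := ultraFilterLemma (T := nat) (F := \oo) _.
have PU : ProperFilter U := ultra_proper.
have [x' xx'] := ultralimit x UU; have [y' yy'] := ultralimit y UU.
have near_agree (T : config R A -> config R A) m (z : nat -> config R A) z' :
    continuous T -> z @ U --> z' ->
    U [set n | agree (window 0 m) (T z') (T (z n))].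
  by move=> cT zz'; exact: (cvg_comp z T zz' (cT z') _ (nbhs_window (T z') m)).
have x'y' : x' = y'.
  apply: sep => i.
  have iU : U [set n | (i < n)%N] by apply: ooU; exact: nbhs_infty_gt.
  have ax := near_agree _ (w i) _ _ (cH i) xx'.
  have ay := near_agree _ (w i) _ _ (cH i) yy'.
  have [n [[{}ax {}ay] lt_in]] := filter_ex (filterI (filterI ax ay) iU).
  apply: agree_trans ax _; apply: agree_trans ((xyP n).1 i lt_in) _.
  exact: agree_sym.
have ax := near_agree _ k _ _ cG xx'; have ay := near_agree _ k _ _ cG yy'.
have [n [{}ax {}ay]] := filter_ex (filterI ax ay).
case: (xyP n) => _; apply; apply: agree_trans (agree_sym ax) _.
by rewrite x'y'.
Qed.

End Configurations.

(** * Radius and uniform expansivity *)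

Section Dynamics.
Context {R : realType} {A : finType}.
Implicit Types (x y : config R A) (F : config R A -> config R A).

Definition translate (c : int) x : config R A := fun i => x (i + c).

Lemma agree_translate c k x y :
  agree (window 0 k) (translate c x) (translate c y) <->
  agree (window c k) x y.
Proof.
split=> xy j jk; last by apply: xy; move: jk; rewrite /window /=; lia.
have := xy (j - c); rewrite /translate subrK; apply.
by move: jk; rewrite /window /= subr0.
Qed.

Lemma translateD c d x : translate c (translate d x) = translate (c + d) x.
Proof. by apply: funext => i; rewrite /translate addrA. Qed.

Lemma ca_translate F c x : cellular_automaton F ->
  F (translate c x) = translate c (F x).
Proof.
move=> [_ Fshift].
have Fn (n : nat) z : F (translate n%:Z z) = translate n%:Z (F z).
  elim: n z => [|n IHn] z.
    have t0 t : translate 0 t = t by apply: funext => i; rewrite /translate addr0.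
    by rewrite !t0.
  have tS t : translate n.+1%:Z t = cshift (translate n%:Z t).
    apply: funext => i; rewrite /cshift /translate; congr t; lia.
  by rewrite !tS Fshift IHn.
case: (lerP 0 c) => [|c_lt0]; first by case: c.
have [n ->] : exists n : nat, c = - n%:Z by exists `|c|%N; lia.
have tNK z : translate (- n%:Z) (translate n%:Z z) = z.
  by rewrite translateD addNr; apply: funext => i; rewrite /translate addr0.
have tKN z : translate n%:Z (translate (- n%:Z) z) = z.
  by rewrite translateD addrN; apply: funext => i; rewrite /translate addr0.
by rewrite -[in RHS](tKN x) Fn tNK.
Qed.

Lemma iter_translate F n c x : cellular_automaton F ->
  iter n F (translate c x) = translate c (iter n F x).
Proof. by move=> caF; elim: n => //= n ->; rewrite ca_translate. Qed.

(** The coordinates form a separating sequence of observations; finitely many of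
    them determine cell [0] of the image, and the shift transports this to any
    cell. *)
Lemma ca_radius F : cellular_automaton F ->
  exists r : nat, forall c x y, agree (window c r) x y -> F x c = F y c.
Proof.
move=> caF; have [cF _] := caF.
have [|||r rP] := @finite_observation R A (fun=> @id (config R A)) id F 0.
- by move=> _ x; exact: cvg_id.
- exact: cF.
- move=> x y xy; apply: funext => j; apply: (xy `|j|%N).
  by rewrite /window /= subr0; lia.
exists r => c x y /agree_translate xy.
have := rP (translate c x) (translate c y).
rewrite !ca_translate// => /(_ _ 0); rewrite /translate add0r; apply.
  by move=> i ir j jr; apply: xy; move: jr; rewrite /window /=; lia.
by rewrite /window /= subrr.
Qed.

Lemma expansive_window F : positively_expansive F -> exists p : nat,
  forall x y, (forall n, agree (window 0 p) (iter n F x) (iter n F y)) -> x = y.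
Proof.
move=> [e e0 expF]; have [p pe] := inv_expn_lt e0.
exists p => x y xy; apply: contrapT => /expF[n].
apply/negP; rewrite -ltNge; apply: lt_trans pe.
exact/mdist_windowP/xy.
Qed.

(** Here the observations are the iterates, all read through the expansivity
    window. The gain of a single cell, [p.+1] against [p], is what drives the
    propagation along half lines. *)
Lemma uniform_expansivity F : cellular_automaton F -> positively_expansive F ->
  exists p N : nat, forall c x y,
    (forall i, (i < N)%N -> agree (window c p) (iter i F x) (iter i F y)) ->
    agree (window c p.+1) x y.
Proof.
move=> caF /expansive_window[p pP]; have [cF _] := caF; exists p.
have [|||N NP] := @finite_observation R A (fun i => iter i F) (fun=> p) id p.+1.
- elim=> [|i IHi] x; first exact: cvg_id.
  exact: (cvg_comp (iter i F) F (IHi x) (cF _)).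
- by move=> x; exact: cvg_id.
- exact: pP.
exists N => c x y xy; apply/agree_translate; apply: NP => i iN.
by rewrite !iter_translate//; apply/agree_translate/xy.
Qed.

(** * Propagation along half lines *)

(** The line is read left to right or right to left, so that both exponents
    concern half lines on which the oriented coordinate is bounded above. *)
Definition side (b : bool) (j : int) : int := if b then j else - j.

Definition ray (b : bool) (s : int) : set int := [set j | side b j <= s].

(** The common form of [Iminus] (for [b = true]) and [Iplus] (for [b = false]). *)
Definition front (b : bool) F (n : nat) x : nat :=
  min_nat [set s : nat | forall i : nat, (1 <= i <= n)%N -> forall y,
    agree (ray b s%:Z) x y -> agree (ray b 0) (iter i F x) (iter i F y)].

Lemma Iminus_front F n x : Iminus F n x = front true F n x.
Proof.
congr min_nat; apply/seteqP; split=> s /= sP i ni.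
  move=> y xy j j0; apply/esym; apply: (sP i ni) => //.
  by exists y => // k ks; rewrite xy.
by move=> _ [y xy <-] j j0; apply/esym; apply: (sP i ni) => // k ks; rewrite xy.
Qed.

Lemma Iplus_front F n x : Iplus F n x = front false F n x.
Proof.
congr min_nat; apply/seteqP; split=> s /= sP i ni.
  move=> y xy j; rewrite /ray /= => j0; apply/esym; apply: (sP i ni); last lia.
  by exists y => // k ks; rewrite xy// /ray /=; lia.
move=> _ [y xy <-] j j0; apply/esym; apply: (sP i ni); last by rewrite /ray/=; lia.
by move=> k; rewrite /ray /= => ks; rewrite xy//; lia.
Qed.

(** A minimum over an empty set would be the default value [0]; the bound [n * r]
    with [r] the radius shows that the minimum is attained. *)
Lemma frontP b F n x : cellular_automaton F ->
  forall i, (1 <= i <= n)%N -> forall y,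
    agree (ray b (front b F n x)%:Z) x y ->
    agree (ray b 0) (iter i F x) (iter i F y).
Proof.
move=> /ca_radius[r rP].
have step (s : nat) x' y' :
    agree (ray b (s + r)%N%:Z) x' y' -> agree (ray b s%:Z) (F x') (F y').
  move=> xy c cs; apply: rP => j jc; apply: xy.
  by move: cs jc; rewrite /ray /window /= /side; case: (b); lia.
have steps i (s : nat) x' y' : agree (ray b (s + i * r)%N%:Z) x' y' ->
    agree (ray b s%:Z) (iter i F x') (iter i F y').
  elim: i s => [|i IHi] s xy; first by move: xy; rewrite mul0n addn0.
  by rewrite !iterS; apply: step; apply: IHi; move: xy; rewrite mulSn addnA.
rewrite /front; set S := [set s | _].
have /min_natP[+ _] : S !=set0; last by apply.
exists (n * r)%N => i /andP[_ ni] y xy.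
apply: (steps i 0%N) => j jr; apply: xy.
have : (0 + i * r <= n * r)%N by rewrite add0n leq_mul2r ni orbT.
by move: jr; rewrite /ray /=; lia.
Qed.

(** Each cell gained beyond the boundary costs [N] units of time. *)
Lemma ray_propagation b F (p N : nat) x y (n : nat) :
    (forall c x y,
      (forall i, (i < N)%N -> agree (window c p) (iter i F x) (iter i F y)) ->
      agree (window c p.+1) x y) ->
    (forall i, (i <= n)%N -> agree (ray b 0) (iter i F x) (iter i F y)) ->
  forall k i, (i + k * N <= n)%N ->
    agree (ray b k%:Z) (iter i F x) (iter i F y).
Proof.
move=> expN xy; elim=> [|k IHk] i; first by rewrite mul0n addn0; exact: xy.
rewrite mulSn => le_n j; rewrite /ray /= => jk.
(* The window of radius [p] around [c] lies just inside the ray of level [k],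
   and the one of radius [p.+1] contains the cell of level [k + 1]. *)
pose c := if b then k%:Z - p%:Z else p%:Z - k%:Z.
have [jk'|kj] := lerP (side b j) k%:Z.
  by apply: IHk jk'; apply: leq_trans le_n; rewrite leq_add2l leq_addl.
apply: (expN c); last by move: jk kj; rewrite /window /c /= /side; case: (b); lia.
move=> m mN l lc; rewrite -!iterD; apply: IHk.
  by apply: leq_trans le_n; rewrite addnA leq_add2r addnC leq_add2l ltnW.
by move: lc; rewrite /ray /window /c /= /side; case: (b); lia.
Qed.

(** The estimate of a front from below, in a division-free form. At [n = 0] it
    also says that [N] is positive. *)
Lemma front_speed F : (1 < #|A|)%N ->
    cellular_automaton F -> positively_expansive F ->
  exists N : nat, forall b n x, (n < (front b F n x).+1 * N)%N.
Proof.
move=> cardA caF /(uniform_expansivity caF)[p [N expN]].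
exists N => b n x; rewrite ltnNge; apply/negP => le_n.
set s := front b F n x in le_n.
(* The first cell that is invisible from the ray of level [s]. *)
pose c := if b then s.+1%:Z else - s.+1%:Z.
have [a ac] : exists a, a != x c.
  have /card_gt0P[a ac] : (0 < #|predC1 (x c)|)%N.
    by rewrite cardC1 -subn1 subn_gt0.
  by exists a.
pose y : config R A := fun j => if j == c then a else x j.
have xy : agree (ray b s%:Z) x y.
  move=> j js; rewrite /y; case: eqP => // jc; exfalso.
  by move: js; rewrite jc /ray /c /= /side; case: (b); lia.
have xyi i : (i <= n)%N -> agree (ray b 0) (iter i F x) (iter i F y).
  (* The front only constrains positive times; at time [0] agreement holds since
     the level [s] is nonnegative. *)
  case: i => [_ j j0|i ni]; last exact: (@frontP b F n x caF i.+1 ni).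
  by apply: xy; move: j0; rewrite /ray /=; lia.
have := @ray_propagation b F p N x y n expN xyi s.+1 0%N le_n c.
suff sc : ray b s.+1%:Z c.
  by move=> /(_ sc)/=/eqP; rewrite /y eqxx eq_sym (negbTE ac).
by rewrite /ray /c /= /side; case: (b); lia.
Qed.

End Dynamics.

(** * Lower limits *)

Lemma limn_einf_ge (R : realType) (u : nat -> \bar R) (a : \bar R) :
  (\forall n \near \oo, (a <= u n)%E) -> (a <= limn_einf u)%E.
Proof.
move=> au; rewrite (_ : limn_einf u = limf_einf u \oo)// limf_einfE.
apply: le_trans (ereal_sup_ubound _); last first.
  by exists [set n | (a <= u n)%E].
by apply/ereal_infP => _ [n an <-].
Qed.

Theorem proposition1 (R : realType) (A : finType) (cardA : (1 < #|A|)%N)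
    (F : config R A -> config R A) :
  cellular_automaton F -> positively_expansive F ->
  exists2 Lambda : R, 0 < Lambda &
    forall x : config R A,
      (Lambda%:E <= lambda_plus F x)%E /\ (Lambda%:E <= lambda_minus F x)%E.
Proof.
move=> caF expF; have [N NP] := front_speed cardA caF expF.
(* A configuration is needed to derive [0 < N] from [front_speed]. *)
have [|x0] := pselect (exists x : config R A, True); last first.
  by exists 1 => // x; exfalso; apply: x0; exists x.
move=> [x0 _].
have N0 : (0 < N)%N by have := NP true 0%N x0; rewrite muln_gt0 => /andP[].
exists (N.*2%:R^-1); first by rewrite invr_gt0 ltr0n double_gt0.
have speed b x : ((N.*2%:R^-1)%:E <=
    limn_einf (fun n => ((front b F n x)%:R / n%:R : R)%:E))%E.
  apply: limn_einf_ge; near=> n.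
  have n2N : (N.*2 <= n)%N by near: n; exact: nbhs_infty_ge.
  have n0 : (0 < n)%N by apply: leq_trans n2N; rewrite double_gt0.
  rewrite lee_fin ler_pdivlMr ?ltr0n// mulrC ler_pdivrMr ?ltr0n ?double_gt0//.
  rewrite -natrM ler_nat.
  have := NP b n x; rewrite mulSn -doubleMr; move: n2N.
  by rewrite -!addnn; lia.
move=> x; split.
- rewrite /lambda_plus; under eq_fun do rewrite Iplus_front; exact: speed.
- rewrite /lambda_minus; under eq_fun do rewrite Iminus_front; exact: speed.
Unshelve. all: by end_near.
Qed.
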